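(* The $(-1)$-scaled hyperbolic ring $\mathbb{D}_{-1}$ is (isomorphic to) the complex field $\mathbb{C}$, and the $1$-scaled hyperbolic ring $\mathbb{D}_1$ is (isomorphic to) the ring $\mathcal{D}$ of all hyperbolic numbers.
   Context: For $t\in\mathbb{R}$, the $t$-scaled hypercomplex ring $\mathbb{H}_t$ is the set $\mathbb{C}^2$ with the usual vector addition and the multiplication $(a_1,b_1)\cdot_t(a_2,b_2)=(a_1a_2+t\,b_1\overline{b_2},\;a_1b_2+b_1\overline{a_2})$. The $t$-scaled hyperbolic ring is its subring $\mathbb{D}_t=\{(x,y)\in\mathbb{H}_t:x,y\in\mathbb{R}\}$. The ring of hyperbolic numbers is $\mathcal{D}=\{x+yj:x,y\in\mathbb{R}\}$ with $j^2=1$, componentwise addition and $(x_1+y_1j)(x_2+y_2j)=(x_1x_2+y_1y_2)+(x_1y_2+x_2y_1)j$. *)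

(* Defs.v *)
From HB Require Import structures.
From mathcomp Require Import all_boot all_order all_algebra.
From mathcomp Require Import complex reals ring.

Set Implicit Arguments.
Unset Strict Implicit.
Unset Printing Implicit Defensive.

Import GRing.Theory Num.Theory.
Local Open Scope ring_scope.

(* The scale [t] is a phantom argument of the carrier: it only selects the
   multiplication. The alias hides the componentwise product of [R[i] * R[i]]. *)
Definition hypercomplex (R : realType) (t : R) : Type := (R[i] * R[i])%type.

HB.instance Definition _ (R : realType) (t : R) :=
  GRing.Zmodule.copy (hypercomplex t) (R[i] * R[i])%type.

Definition hypercomplex_one (R : realType) (t : R) : hypercomplex t := (1, 0).

Definition hypercomplex_mul (R : realType) (t : R) (u v : hypercomplex t) :
    hypercomplex t :=
  (u.1 * v.1 + t%:C%C * (u.2 * conjc v.2), u.1 * v.2 + u.2 * conjc v.1).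

Section HypercomplexRing.
Context (R : realType) (t : R).
Local Notation Ht := (hypercomplex t).

Fact hypercomplex_mulA : associative (@hypercomplex_mul R t).
Proof.
move=> [a1 b1] [a2 b2] [a3 b3]; rewrite /hypercomplex_mul /=.
have := conjc_real t; move: (t%:C%C) => c conj_c.
rewrite !(rmorphD, rmorphM) /= !conjcK conj_c.
by congr pair; ring.
Qed.

Fact hypercomplex_mul1l : left_id (hypercomplex_one t) (@hypercomplex_mul R t).
Proof.
by move=> [a b]; rewrite /hypercomplex_mul /= !mul1r !mul0r mulr0 !addr0.
Qed.

Fact hypercomplex_mul1r : right_id (hypercomplex_one t) (@hypercomplex_mul R t).
Proof.
move=> [a b].
by rewrite /hypercomplex_mul conjc0 conjc1 /= !mulr1 !mulr0 addr0 add0r.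
Qed.

Fact hypercomplex_mulDl : left_distributive (@hypercomplex_mul R t) +%R.
Proof.
move=> [a1 b1] [a2 b2] [a3 b3]; rewrite /hypercomplex_mul.
by rewrite -[(a1, b1) + _]/(a1 + a2, b1 + b2) /=; congr pair; rewrite /=; ring.
Qed.

Fact hypercomplex_mulDr : right_distributive (@hypercomplex_mul R t) +%R.
Proof.
move=> [a1 b1] [a2 b2] [a3 b3]; rewrite /hypercomplex_mul.
rewrite -[(a2, b2) + _]/(a2 + a3, b2 + b3) /=.
by rewrite !rmorphD /=; congr pair; rewrite /=; ring.
Qed.

Fact hypercomplex_one_neq0 : hypercomplex_one t != 0.
Proof. by apply/eqP => -[/eqP]; rewrite oner_eq0. Qed.

HB.instance Definition _ := GRing.Zmodule_isNzRing.Build Ht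
  hypercomplex_mulA hypercomplex_mul1l hypercomplex_mul1r
  hypercomplex_mulDl hypercomplex_mulDr hypercomplex_one_neq0.

(* For [z : R[i]], [z \is Num.real] says that [z] has imaginary part 0. *)
Definition is_hyperbolic : {pred Ht} :=
  [pred u : Ht | (u.1 \is Num.real) && (u.2 \is Num.real)].

Fact is_hyperbolic_subring : subring_closed is_hyperbolic.
Proof.
split.
- by rewrite inE /= real1 real0.
- move=> u v /andP[u1 u2] /andP[v1 v2].
  by apply/andP; split; apply: rpredB.
- move=> u v /andP[u1 u2] /andP[v1 v2].
  have t_real : t%:C%C \is Num.real by rewrite complex_real.
  have conj_real (z : R[i]) : z \is Num.real -> conjc z \is Num.real.
    by move=> /complex_realP[k ->]; rewrite conjc_real complex_real.
  by apply/andP; split; rewrite /= ?rpredD ?rpredM ?conj_real.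
Qed.

HB.instance Definition _ :=
  GRing.isSubringClosed.Build Ht is_hyperbolic is_hyperbolic_subring.

End HypercomplexRing.

Definition scaled_hyperbolic (R : realType) (t : R) : Type :=
  {u : hypercomplex t | u \in @is_hyperbolic R t}.

HB.instance Definition _ (R : realType) (t : R) :=
  SubChoice.on (scaled_hyperbolic t).
HB.instance Definition _ (R : realType) (t : R) :=
  [SubChoice_isSubNzRing of scaled_hyperbolic t by <:].

(* The pair [(x, y)] stands for [x + y j], with [j ^+ 2 = 1]. *)
Definition hyperbolic_number (R : realType) : Type := (R * R)%type.

HB.instance Definition _ (R : realType) :=
  GRing.Zmodule.copy (hyperbolic_number R) (R * R)%type.

Definition hyperbolic_number_one (R : realType) : hyperbolic_number R := (1, 0).

Definition hyperbolic_number_mul (R : realType) (u v : hyperbolic_number R) :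
    hyperbolic_number R :=
  (u.1 * v.1 + u.2 * v.2, u.1 * v.2 + v.1 * u.2).

Section HyperbolicNumberRing.
Context (R : realType).

Fact hyperbolic_number_mulA : associative (@hyperbolic_number_mul R).
Proof.
by move=> [a1 b1] [a2 b2] [a3 b3]; congr pair; rewrite /=; ring.
Qed.

Fact hyperbolic_number_mulC : commutative (@hyperbolic_number_mul R).
Proof.
by move=> [a1 b1] [a2 b2]; congr pair; rewrite /=; ring.
Qed.

Fact hyperbolic_number_mul1l :
  left_id (hyperbolic_number_one R) (@hyperbolic_number_mul R).
Proof.
by move=> [a b]; rewrite /hyperbolic_number_mul /= !mul1r mul0r mulr0 !addr0.
Qed.

Fact hyperbolic_number_mulDl :
  left_distributive (@hyperbolic_number_mul R) +%R.
Proof.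
move=> [a1 b1] [a2 b2] [a3 b3]; rewrite /hyperbolic_number_mul.
by rewrite -[(a1, b1) + _]/(a1 + a2, b1 + b2) /=; congr pair; rewrite /=; ring.
Qed.

Fact hyperbolic_number_one_neq0 : hyperbolic_number_one R != 0.
Proof. by apply/eqP => -[/eqP]; rewrite oner_eq0. Qed.

HB.instance Definition _ := GRing.Zmodule_isComNzRing.Build
  (hyperbolic_number R) hyperbolic_number_mulA hyperbolic_number_mulC
  hyperbolic_number_mul1l hyperbolic_number_mulDl hyperbolic_number_one_neq0.

End HyperbolicNumberRing.

Definition ring_isomorphic (A B : nzRingType) : Prop :=
  exists f : {rmorphism A -> B}, bijective f.

(* Main.v *)
Require Import Defs.
From HB Require Import structures.
From mathcomp Require Import all_boot all_order all_algebra.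
From mathcomp Require Import complex reals.

(** An element of the scaled hyperbolic ring of scale [t] is a pair of complex
    numbers with zero imaginary part, so it is the same thing as a pair [(x, y)]
    of elements of [R]. On such pairs the conjugation in the hypercomplex
    product is trivial, and the product becomes
    [(x1 x2 + t y1 y2, x1 y2 + y1 x2)]: this is the ring [R[X] / (X^2 - t)].
    At [t = -1] the second basis vector squares to [-1], which is the complex
    field; at [t = 1] it squares to [1], which is the ring of hyperbolic
    numbers. In the basis formed by [1] and the square root of [t], both target
    rings have additive group [R * R], so
    [ring_isomorphic_of_coords] reduces the claim to comparing product formulas. *)

Import GRing.Theory Num.Theory.
Local Open Scope ring_scope.

Section Coordinates.
Context {R : realType} {t : R}.

Definition coords (u : scaled_hyperbolic t) : R * R :=
  (complex.Re (val u).1, complex.Re (val u).2).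

Fact of_coords_subproof (p : R * R) :
  ((p.1%:C%C, p.2%:C%C) : hypercomplex t) \in @is_hyperbolic R t.
Proof. by apply/andP; split; rewrite complex_real. Qed.

Definition of_coords (p : R * R) : scaled_hyperbolic t :=
  exist (fun u => u \in @is_hyperbolic R t) _ (of_coords_subproof p).

Lemma coordsK : cancel coords of_coords.
Proof.
move=> [[a b] u_real]; apply: val_inj; case/andP: (u_real) => /=.
by move=> /complex_realP[x ->] /complex_realP[y ->].
Qed.

Lemma of_coordsK : cancel of_coords coords.
Proof. by case=> x y. Qed.

Lemma coordsB : {morph coords : u v / u - v}.
Proof.
by move=> [[[a a'] [b b']] u_real] [[[c c'] [d d']] v_real].
Qed.

Lemma coords1 : coords 1 = (1, 0).
Proof. by []. Qed.

(** This is where [conjc] disappears: it fixes the real components. *)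
Lemma coordsM (u v : scaled_hyperbolic t) :
  coords (u * v) =
    ((coords u).1 * (coords v).1 + t * ((coords u).2 * (coords v).2),
     (coords u).1 * (coords v).2 + (coords u).2 * (coords v).1).
Proof.
rewrite -(coordsK u) -(coordsK v) !of_coordsK.
move: (coords u) (coords v) => [x1 y1] [x2 y2].
by rewrite /coords /= !(mulr0, mul0r, oppr0, subr0, addr0).
Qed.

End Coordinates.

(** A ring whose additive group is [R * R] is isomorphic to the scaled
    hyperbolic ring as soon as its product is given by the formula of
    [coordsM]; [g] identifies the two groups. *)
Lemma ring_isomorphic_of_coords (R : realType) (t : R) (S : nzRingType)
    (g : R * R -> S) :
    bijective g -> {morph g : p q / p - q} -> g (1, 0) = 1 ->
    (forall x1 y1 x2 y2 : R,
       g (x1 * x2 + t * (y1 * y2), x1 * y2 + y1 * x2) =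
       g (x1, y1) * g (x2, y2)) ->
  ring_isomorphic (scaled_hyperbolic t) S.
Proof.
move=> g_bij gB g1 gM; pose f (u : scaled_hyperbolic t) := g (coords u).
have fB : zmod_morphism f by move=> u v; rewrite /f coordsB gB.
have fM : monoid_morphism f.
  split; first by rewrite /f coords1.
  by move=> u v; rewrite /f coordsM gM -!surjective_pairing.
pose fadd := GRing.isZmodMorphism.Build _ _ f fB.
pose fmul := GRing.isMonoidMorphism.Build _ _ f fM.
pose F : {rmorphism scaled_hyperbolic t -> S} := HB.pack f fadd fmul.
exists F; apply: (bij_comp g_bij).
by exists of_coords; [exact: coordsK | exact: of_coordsK].
Qed.

Theorem corollary6p4 (R : realType) :
  ring_isomorphic (scaled_hyperbolic (-1 : R)) R[i] /\
  ring_isomorphic (scaled_hyperbolic (1 : R)) (hyperbolic_number R).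
Proof.
split.
- apply: (@ring_isomorphic_of_coords R (-1) R[i] (fun p => (p.1 +i* p.2)%C)).
  + by exists (fun z => (complex.Re z, complex.Im z)); case.
  + by case=> ? ? [].
  + by [].
  + by move=> x1 y1 x2 y2; rewrite /= mulN1r.
- apply: (@ring_isomorphic_of_coords R 1 (hyperbolic_number R) id).
  + by exists id.
  + by [].
  + by [].
  + by move=> x1 y1 x2 y2; rewrite mul1r (mulrC y1 x2).
Qed.
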